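(* Let $S$ and $T$ be classical propositional statement forms in finitely many letters, and let $g(S)$ and $g(T)$ be the Boolean polynomials associated with them by the PBNF-transform. If $g(S)$ and $g(T)$ reduce to the same normal form, then $S$ and $T$ are logically equivalent. Further, PBNF is a canonical form: if $S$ and $T$ are logically equivalent, then $g(S)$ and $g(T)$ reduce to the same normal form.
   Context: Truth values are $1$ (true) and $0$ (false). Statement forms are built from propositional letters (such as $p,q,r$) and the constants $0,1$ using negation $\neg$ and the binary connectives $\wedge,\vee,\Rightarrow,\Leftarrow,\Leftrightarrow,\uparrow$ (NAND), $\downarrow$ (NOR), $|$ (XOR). Two statement forms are logically equivalent if they have the same truth value under every assignment of truth values to the letters. The PBNF-transform $g$ (in the normal family $g(p,q,1)$) sends each letter to the variable of the same name and each constant to itself, and is defined recursively by substitution: writing $P=g(A)$, $Q=g(B)$, one has $g(\neg A)=P+1$, $g(A\wedge B)=PQ$, $g(A\vee B)=(P+1)(Q+1)+1$, $g(A\Rightarrow B)=P(Q+1)+1$, $g(A\Leftarrow B)=(P+1)Q+1$, $g(A\Leftrightarrow B)=P+Q+1$, $g(A\uparrow B)=PQ+1$, $g(A\downarrow B)=(P+1)(Q+1)$, $g(A\,|\,B)=P+Q$. The resulting polynomials have coefficients in $\mathbb{Z}_2$. Their normal form is obtained by expanding and reducing with the rules $x+x=0$ and $x\cdot x=x$, i.e. it is the multilinear (square-free) polynomial over $\mathbb{Z}_2$ representing the class of the polynomial modulo the relations $x^2=x$ for each variable $x$. *)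

(* Defs.v *)
From mathcomp Require Import all_boot all_order all_algebra.
From HB Require Import structures.
From mathcomp Require Import ssrcomplements.
From mathcomp Require Export mpoly.

Set Implicit Arguments.
Unset Strict Implicit.
Unset Printing Implicit Defensive.

Import GRing.Theory.
Local Open Scope ring_scope.

Inductive statement_form (n : nat) : Type :=
  | Letter of 'I_n
  | Const of bool
  | Not of statement_form n
  | And of statement_form n & statement_form n
  | Or of statement_form n & statement_form n
  | Imp of statement_form n & statement_form n
  | ConvImp of statement_form n & statement_form n
  | Iff of statement_form n & statement_form n
  | Nand of statement_form n & statement_form n
  | Nor of statement_form n & statement_form n
  | Xor of statement_form n & statement_form n.

Fixpoint truth n (v : 'I_n -> bool) (S : statement_form n) : bool :=
  match S with
  | Letter i => v i
  | Const b => b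
  | Not A => ~~ truth v A
  | And A B => truth v A && truth v B
  | Or A B => truth v A || truth v B
  | Imp A B => truth v A ==> truth v B
  | ConvImp A B => truth v B ==> truth v A
  | Iff A B => truth v A == truth v B
  | Nand A B => ~~ (truth v A && truth v B)
  | Nor A B => ~~ (truth v A || truth v B)
  | Xor A B => truth v A (+) truth v B
  end.

Definition logically_equivalent n (S T : statement_form n) : Prop :=
  forall v : 'I_n -> bool, truth v S = truth v T.

Fixpoint pbnf n (S : statement_form n) : {mpoly 'F_2[n]} :=
  match S with
  | Letter i => 'X_i
  | Const b => if b then 1 else 0
  | Not A => pbnf A + 1
  | And A B => pbnf A * pbnf B
  | Or A B => (pbnf A + 1) * (pbnf B + 1) + 1
  | Imp A B => pbnf A * (pbnf B + 1) + 1
  | ConvImp A B => (pbnf A + 1) * pbnf B + 1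
  | Iff A B => pbnf A + pbnf B + 1
  | Nand A B => pbnf A * pbnf B + 1
  | Nor A B => (pbnf A + 1) * (pbnf B + 1)
  | Xor A B => pbnf A + pbnf B
  end.

(* Exhaustive use of x * x = x on a monomial cuts every exponent down to at
   most 1.  The rule x + x = 0 holds in {mpoly 'F_2[n]} already. *)
Definition reduce_mnm n (m : 'X_{1..n}) : 'X_{1..n} :=
  [multinom minn (m i) 1 | i < n].

Definition normal_form n (p : {mpoly 'F_2[n]}) : {mpoly 'F_2[n]} :=
  \sum_(m <- msupp p) p@_m *: 'X_[reduce_mnm m].

Definition multilinear n (p : {mpoly 'F_2[n]}) : Prop :=
  forall m, m \in msupp p -> forall i, (m i <= 1)%N.

(* p and q agree modulo the ideal generated by the x^2 - x. *)
Definition boolean_congr n (p q : {mpoly 'F_2[n]}) : Prop :=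
  exists c : 'I_n -> {mpoly 'F_2[n]},
    p - q = \sum_(i < n) c i * ('X_i ^+ 2 - 'X_i).

Lemma normal_formwE n (p : {mpoly 'F_2[n]}) k : (msize p <= k)%N ->
  normal_form p = \sum_(m : 'X_{1..n < k}) p@_m *: 'X_[reduce_mnm m].
Proof.
move=> lt_pk; pose I : subFinType _ := 'X_{1..n < k}.
rewrite /normal_form (big_mksub I) //=; first last.
- by move=> x /msize_mdeg_lt /leq_trans; apply.
- by rewrite msupp_uniq.
rewrite big_rmcond //= => i.
by move/memN_msupp_eq0 ->; rewrite scale0r.
Qed.

Lemma normal_form_is_linear n : linear (@normal_form n).
Proof.
move=> a p q; pose k := maxn (msize (a *: p + q)) (maxn (msize p) (msize q)).
have [h1 [h2 h3]] : (msize (a *: p + q) <= k /\ msize p <= k /\ msize q <= k)%N.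
  by rewrite /k !leq_max !leqnn !orbT.
rewrite (normal_formwE h1) (normal_formwE h2) (normal_formwE h3).
rewrite scaler_sumr -big_split /=; apply: eq_bigr => m _.
by rewrite linearP /= scalerDl scalerA.
Qed.

HB.instance Definition _ n := GRing.isLinear.Build _ _ _ _ (@normal_form n)
  (@normal_form_is_linear n).

Lemma normal_formX n (m : 'X_{1..n}) :
  normal_form 'X_[m] = 'X_[reduce_mnm m].
Proof. by rewrite /normal_form msuppX big_seq1 mcoeffX eqxx scale1r. Qed.

Lemma normal_form_multilinear n (p : {mpoly 'F_2[n]}) :
  multilinear (normal_form p).
Proof.
move=> m; rewrite mcoeff_msupp /normal_form raddf_sum /= => /eqP nz i.
case: (leqP (m i) 1) => // lt1; case: nz; rewrite big1 // => m' _.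
rewrite mcoeffZ mcoeffX; case: eqP => [e|_]; last by rewrite mulr0.
by move: lt1; rewrite -e mnmE ltnNge geq_minr.
Qed.

Lemma normal_form_id n (p : {mpoly 'F_2[n]}) :
  multilinear p -> normal_form p = p.
Proof.
move=> mp; rewrite [RHS]mpolyE; apply: eq_big_seq => m /mp le1.
by congr (_ *: 'X_[_]); apply/mnmP => i; rewrite mnmE; apply/minn_idPl.
Qed.

Lemma boolean_congr_refl n (p : {mpoly 'F_2[n]}) : boolean_congr p p.
Proof. by exists (fun=> 0); rewrite subrr big1 // => i _; rewrite mul0r. Qed.

Lemma boolean_congrD n (p p' q q' : {mpoly 'F_2[n]}) :
  boolean_congr p q -> boolean_congr p' q' -> boolean_congr (p + p') (q + q').
Proof.
move=> [c e] [c' e']; exists (fun i => c i + c' i).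
under eq_bigr do rewrite mulrDl.
by rewrite big_split /= -e -e' opprD addrACA.
Qed.

Lemma boolean_congrM n (p p' q q' : {mpoly 'F_2[n]}) :
  boolean_congr p q -> boolean_congr p' q' -> boolean_congr (p * p') (q * q').
Proof.
move=> [c e] [c' e']; exists (fun i => p' * c i + q * c' i).
under eq_bigr do rewrite mulrDl -!mulrA.
rewrite big_split /= -!mulr_sumr -e -e' !mulrBr (mulrC p') (mulrC p').
by rewrite addrA subrK.
Qed.

Lemma boolean_congrX n (i : 'I_n) k :
  boolean_congr ('X_i ^+ k) ('X_i ^+ minn k 1).
Proof.
have idem : boolean_congr ('X_i ^+ 2) ('X_i : {mpoly 'F_2[n]}).
  exists (fun j => (j == i)%:R); rewrite (bigD1 i) //= eqxx mul1r big1 ?addr0 //.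
  by move=> j /negbTE ->; rewrite mul0r.
have trans (p q r : {mpoly 'F_2[n]}) :
    boolean_congr p q -> boolean_congr q r -> boolean_congr p r.
  move=> h1 h2; have := boolean_congrD h1 h2; case=> c; rewrite [q + r]addrC.
  by rewrite opprD addrACA subrr addr0 => e; exists c.
elim: k => [|[|k] IHk]; do ?exact: boolean_congr_refl.
rewrite exprS; apply: trans idem.
exact: boolean_congrM (boolean_congr_refl _) IHk.
Qed.

Lemma boolean_congr_normal_form n (p : {mpoly 'F_2[n]}) :
  boolean_congr p (normal_form p).
Proof.
rewrite {1}[p]mpolyE /normal_form.
apply: (big_ind2 (@boolean_congr n)); first exact: boolean_congr_refl.
  by move=> *; apply: boolean_congrD.
move=> m _; rewrite -!mul_mpolyC; apply: boolean_congrM.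
  exact: boolean_congr_refl.
rewrite !mpolyXE_id.
apply: (big_ind2 (@boolean_congr n)); first exact: boolean_congr_refl.
  by move=> *; apply: boolean_congrM.
by move=> i _; rewrite mnmE; apply: boolean_congrX.
Qed.

Lemma normal_form_congr n (p q : {mpoly 'F_2[n]}) :
  boolean_congr p q -> normal_form p = normal_form q.
Proof.
move=> [c e]; apply/eqP; rewrite -subr_eq0 -raddfB /= e raddf_sum /=.
apply/eqP/big1 => i _; rewrite [c i]mpolyE mulr_suml raddf_sum /=.
apply: big1 => m _; rewrite -scalerAl linearZ /= mulrBr raddfB /= expr2.
rewrite -!mpolyXD !normal_formX; set a := reduce_mnm _; set b := reduce_mnm _.
suff -> : a = b by rewrite subrr scaler0.
apply/mnmP => j; rewrite !mnmE.
by case: (i == j); rewrite ?addn0 // addnA addn1 !(minn_idPr _) // addn1.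
Qed.

(* [normal_form p] is the unique multilinear polynomial in the class of p. *)
Lemma normal_formP n (p r : {mpoly 'F_2[n]}) :
  multilinear r /\ boolean_congr p r <-> r = normal_form p.
Proof.
split=> [[mr /normal_form_congr ->]|->]; first by rewrite normal_form_id.
split; [exact: normal_form_multilinear | exact: boolean_congr_normal_form].
Qed.

(* Main.v *)
From mathcomp Require Import all_boot all_order all_algebra.
Require Import Defs.

(** A statement form and its polynomial agree at every 0/1 point, and passing to
    the normal form does not change values there.  Conversely, a multilinear
    polynomial is determined by its values at 0/1 points: at the indicator
    vector of the support of a square-free monomial [m], the only square-free
    monomials that do not vanish are the divisors of [m], so by induction on the
    degree all the coefficients of a vanishing polynomial are zero. *)

Set Implicit Arguments.
Unset Strict Implicit.
Unset Printing Implicit Defensive.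

Import GRing.Theory.
Local Open Scope ring_scope.

Lemma mdeg_ltn n (m1 m2 : 'X_{1..n}) :
  (m1 <= m2)%MM -> m1 != m2 -> (mdeg m1 < mdeg m2)%N.
Proof.
move=> le12 ne12; rewrite -(submK le12) mdegD -[ltnLHS]add0n ltn_add2r lt0n.
rewrite mdeg_eq0; apply: contra ne12 => /eqP e.
by rewrite -[eqbRHS](submK le12) e add0m.
Qed.

Lemma meval_pbnf n (v : 'I_n -> bool) (S : statement_form n) :
  (pbnf S).@[fun i => (v i)%:R] = (truth v S)%:R.
Proof.
elim: S => [i|[]|A hA|A hA B hB|A hA B hB|A hA B hB|A hA B hB|A hA B hB
           |A hA B hB|A hA B hB|A hA B hB] /=;
  rewrite ?(mevalXU, meval0, meval1, mevalD, mevalM) ?hA ?hB //;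
  (* What remains are identities between constants of ['F_2], checked by computing
     representatives. *)
  by case: (truth v A) => //; try case: (truth v B) => //; apply/val_inj.
Qed.

Lemma meval_boolean_congr n (v : 'I_n -> bool) (p q : {mpoly 'F_2[n]}) :
  boolean_congr p q ->
  p.@[fun i => (v i)%:R] = q.@[fun i => (v i)%:R].
Proof.
case=> c e; apply/eqP; rewrite -subr_eq0 -mevalB e raddf_sum /=.
apply/eqP/big1 => i _; rewrite mevalM mevalB expr2 mevalM mevalXU.
(* Each generator [x^2 - x] vanishes at 0 and at 1. *)
by case: (v i); rewrite ?mulr1 ?mulr0 subrr mulr0.
Qed.

Lemma multilinear_eq0 n (p : {mpoly 'F_2[n]}) : multilinear p ->
  (forall v : 'I_n -> bool, p.@[fun i => (v i)%:R] = 0) -> p = 0.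
Proof.
move=> mp p0; apply/mpolyP => m; rewrite mcoeff0.
have [k] := ubnP (mdeg m); elim: k => // k IHk in m * => /ltnSE le_mk.
apply: contraTeq isT => nz_m.
have m_in : m \in msupp p by rewrite mcoeff_msupp.
have := p0 (fun i => m i != 0%N); rewrite mevalE (bigD1_seq m) ?msupp_uniq //=.
(* At its own indicator [m] takes the value 1: each factor has exponent 0 or base 1. *)
rewrite [X in _ * X]big1 => [|i _]; last first.
  by case: (m i) => [|d]; rewrite ?expr0 ?expr1n.
rewrite mulr1 big_seq_cond big1 ?addr0 => [m0|m' /andP[m'_in ne]].
  by rewrite m0 eqxx in nz_m.
have [le|] := boolP (m' <= m)%MM.
  by rewrite (IHk m') ?mul0r // (leq_trans (mdeg_ltn le ne)).
(* A non-divisor [m'] contains a variable missing from [m], as [m i < m' i <= 1]; that factor is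
   0. *)
case/forallPn => i; rewrite -ltnNge => lt_i.
have m'i1 : m' i = 1%N by apply/eqP; rewrite eqn_leq mp // (leq_ltn_trans _ lt_i).
have mi0 : m i = 0%N by apply/eqP; rewrite -leqn0 -ltnS -m'i1.
by rewrite (bigD1 i) //= m'i1 mi0 mul0r mulr0.
Qed.

Lemma multilinearB n (p q : {mpoly 'F_2[n]}) :
  multilinear p -> multilinear q -> multilinear (p - q).
Proof.
move=> mp mq m; rewrite mcoeff_msupp mcoeffB => nz i.
have [/mp //|/memN_msupp_eq0 pm] := boolP (m \in msupp p).
by apply: mq; rewrite mcoeff_msupp; rewrite pm sub0r oppr_eq0 in nz.
Qed.

Theorem theorem3p13 (n : nat) (S T : statement_form n) :
  (normal_form (pbnf S) = normal_form (pbnf T) -> logically_equivalent S T) /\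
  (logically_equivalent S T -> normal_form (pbnf S) = normal_form (pbnf T)).
Proof.
have nfE (v : 'I_n -> bool) U : (normal_form (pbnf U)).@[fun i => (v i)%:R]
               = (truth v U)%:R :> 'F_2.
  by rewrite -(meval_boolean_congr v (boolean_congr_normal_form _)) meval_pbnf.
split=> [eqST v | eqST].
  have := nfE v S; rewrite eqST nfE.
  (* Distinct truth values would give [0 = 1] in ['F_2]. *)
  by case: (truth v S); case: (truth v T).
apply/eqP; rewrite -subr_eq0; apply/eqP/multilinear_eq0 => [|v].
  by apply: multilinearB; apply: normal_form_multilinear.
by rewrite mevalB !nfE eqST subrr.
Qed.
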